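(* Let $V\subset\mathbb C^N$ be an irreducible algebraic variety defined over $\mathbb Q$ and let $\mathbf l$ be a generic point of $V$. Let $\mathbf A$ be a bijective linear map on $\mathbb C^N$, defined over $\mathbb Q$ (i.e. given by a matrix with rational entries), such that $\mathbf A(\mathbf l)\in V$. Then $\mathbf A(V)=V$, that is, $\mathbf A$ is a linear automorphism of $V$.
   Context: A variety in $\mathbb C^N$ is the common zero set of finitely many polynomials with complex coefficients; it is defined over $\mathbb Q$ if it can be defined by polynomials with rational coefficients. It is irreducible if it is not the union of two varieties neither of which contains the other. A point of an irreducible variety $V$ defined over $\mathbb Q$ is generic in $V$ if its coordinates satisfy no polynomial equation with rational coefficients other than those satisfied by every point of $V$. A linear automorphism of $V$ is a bijective linear map of $\mathbb C^N$ that maps $V$ onto $V$. *)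

(* Defs.v *)
From HB Require Import structures.
From mathcomp Require Import all_boot all_order all_algebra.
From mathcomp Require Import complex mpoly.
From mathcomp Require Import boolp classical_sets reals.

Set Implicit Arguments.
Unset Strict Implicit.
Unset Printing Implicit Defensive.

Import GRing.Theory Num.Theory.
Local Open Scope ring_scope.
Local Open Scope complex_scope.
Local Open Scope classical_set_scope.

(* For R : realType (the real numbers), R[i] is the field of complex numbers
   and C^N is the space of column vectors 'cV[R[i]]_N. *)

Definition eval_at (K : comNzRingType) (N : nat) (p : {mpoly K[N]})
    (x : 'cV[K]_N) : K :=
  p.@[fun i => x i 0].

Definition zero_set (K : comNzRingType) (N : nat) (s : seq {mpoly K[N]}) :
    set 'cV[K]_N :=
  [set x | forall p, p \in s -> eval_at p x = 0].

Definition complexify (R : realType) (N : nat) (p : {mpoly rat[N]}) :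
    {mpoly (R[i])[N]} :=
  map_mpoly (@ratr (R[i])) p.

Definition variety (R : realType) (N : nat) (V : set 'cV[R[i]]_N) : Prop :=
  exists s : seq {mpoly (R[i])[N]}, V = zero_set s.

Definition variety_over_Q (R : realType) (N : nat) (V : set 'cV[R[i]]_N) :
    Prop :=
  exists s : seq {mpoly rat[N]}, V = zero_set [seq complexify R p | p <- s].

(* V1 and V2 range over varieties defined over C, not only over Q. *)
Definition irreducible_variety (R : realType) (N : nat)
    (V : set 'cV[R[i]]_N) : Prop :=
  variety V /\
  ~ (exists V1 V2 : set 'cV[R[i]]_N,
      [/\ variety V1, variety V2, V = V1 `|` V2,
          ~ (V1 `<=` V2) & ~ (V2 `<=` V1)]).

Definition generic_point (R : realType) (N : nat) (V : set 'cV[R[i]]_N)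
    (l : 'cV[R[i]]_N) : Prop :=
  V l /\
  forall p : {mpoly rat[N]}, eval_at (complexify R p) l = 0 ->
    forall x, V x -> eval_at (complexify R p) x = 0.

Definition map_over_Q (R : realType) (N : nat)
    (A : 'cV[R[i]]_N -> 'cV[R[i]]_N) : Prop :=
  exists M : 'M[rat]_N, forall x, A x = map_mx (@ratr (R[i])) M *m x.

Definition linear_automorphism (R : realType) (N : nat)
    (V : set 'cV[R[i]]_N) (A : {linear 'cV[R[i]]_N -> 'cV[R[i]]_N}) : Prop :=
  bijective A /\ A @` V = V.

(* Main.v *)
Require Import Defs.
From HB Require Import structures.
From mathcomp Require Import all_boot all_order all_algebra.
From mathcomp Require Import complex mpoly.
From mathcomp Require Import boolp classical_sets reals.

Import GRing.Theory Num.Theory.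
Local Open Scope ring_scope.
Local Open Scope complex_scope.
Local Open Scope classical_set_scope.

(** Write [p o M] for the polynomial obtained from [p] by the linear
    substitution [x |-> M x].

    The inclusion [A(V) <= V] is where genericity enters.  If [p] is one of
    the rational equations of [V], then [p o A] again has rational
    coefficients, because [A] does, and it vanishes at [l], because [A l] lies
    in [V]; so it vanishes on all of [V].

    The inclusion [V <= A(V)] holds for every variety and every invertible
    matrix [M] with [M(V) <= V].  A linear substitution does not raise the
    degree ([msize_mpoly_subst]), so for an equation [p] of [V] the
    polynomials [p], [p o M], [p o M^2], ... all lie in one finite-dimensional
    space and satisfy a nontrivial linear relation
    ([bounded_mpoly_dependent]).  Composing such a relation with a negative
    power of [M] turns it into one that expresses [p o M^-1] as a linear
    combination of the [p o M^k] with [k >= 0].  All of these vanish on [V],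
    as [M] maps [V] into itself, hence so does [p o M^-1]
    ([vanishing_at_preimages]).  When this is applied to all equations of
    [V], it says that [M^-1] maps [V] into [V]. *)

(** * Linear substitutions in polynomials *)

Section LinearSubstitution.

Context {K : idomainType} {N : nat}.
Implicit Types (M : 'M[K]_N) (p : {mpoly K[N]}) (x : 'cV[K]_N).

Definition linear_form M (i : 'I_N) : {mpoly K[N]} := \sum_j M i j *: 'X_j.

Definition mpoly_subst M p : {mpoly K[N]} :=
  p \mPo [tuple linear_form M i | i < N].

Lemma eval_mpoly_subst M p x :
  eval_at (mpoly_subst M p) x = eval_at p (M *m x).
Proof.
rewrite /eval_at /mpoly_subst comp_mpoly_meval; apply: meval_eq => i.
rewrite tnth_mktuple /linear_form raddf_sum mxE.
by apply: eq_bigr => j _; rewrite /= mevalZ mevalXU.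
Qed.

Lemma eval_iter_mpoly_subst M k p x :
  eval_at (iter k (mpoly_subst M) p) x = eval_at p (iter k (mulmx M) x).
Proof.
by elim: k x => // k IHk x; rewrite iterS eval_mpoly_subst IHk iterSr.
Qed.

(* The bounds below are on [msize], which is one more than the degree. *)
Lemma msize_linear_form M i : (msize (linear_form M i) <= 2)%N.
Proof.
apply: leq_trans (msize_sum _ _ _) _; apply/bigmax_leqP => j _.
by apply: leq_trans (msizeZ_le _ _) _; rewrite msizeX mdeg1.
Qed.

Lemma msizeM_bound p q a b :
  (msize p <= a.+1 -> msize q <= b.+1 -> msize (p * q) <= (a + b).+1)%N.
Proof.
move=> pa qb; have [->|p0] := eqVneq p 0; first by rewrite mul0r msize0.
have [->|q0] := eqVneq q 0; first by rewrite mulr0 msize0.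
by rewrite msizeM // -subn1 leq_subLR add1n -addnS -addSn leq_add.
Qed.

Lemma msize_prod_bound (I : Type) (r : seq I) (F : I -> {mpoly K[N]})
    (e : I -> nat) :
  (forall i, msize (F i) <= (e i).+1)%N ->
  (msize (\prod_(i <- r) F i) <= (\sum_(i <- r) e i).+1)%N.
Proof.
move=> Fe; elim/big_rec2: _ => [|i n p _ IH]; first by rewrite msize1.
exact: msizeM_bound.
Qed.

Lemma msizeX_bound p e : (msize p <= 2 -> msize (p ^+ e) <= e.+1)%N.
Proof.
move=> p2; elim: e => [|e IHe]; first by rewrite expr0 msize1.
by rewrite exprS; apply: (msizeM_bound _ _ 1 e).
Qed.

Lemma msize_mpoly_subst M p : (msize (mpoly_subst M p) <= msize p)%N.
Proof.
rewrite /mpoly_subst comp_mpolyEX; apply: leq_trans (msize_sum _ _ _) _.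
apply/bigmax_leqP_seq => m mp _.
apply: leq_trans (msizeZ_le _ _) _.
apply: leq_trans (msize_mdeg_lt mp); rewrite comp_mpolyX mdegE.
apply: msize_prod_bound => j.
by apply: msizeX_bound; rewrite tnth_mktuple msize_linear_form.
Qed.

Lemma msize_iter_mpoly_subst M k p :
  (msize (iter k (mpoly_subst M) p) <= msize p)%N.
Proof.
elim: k => // k IHk; exact: leq_trans (msize_mpoly_subst _ _) IHk.
Qed.

End LinearSubstitution.

Lemma map_mpoly_subst {K L : idomainType} (f : {rmorphism K -> L}) {N : nat}
    (M : 'M[K]_N) (p : {mpoly K[N]}) :
  map_mpoly f (mpoly_subst M p) = mpoly_subst (map_mx f M) (map_mpoly f p).
Proof.
rewrite /mpoly_subst.
elim/mpolyind: p => [|c m p _ _ IHp]; first by rewrite !raddf0.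
rewrite !raddfD /= {}IHp !(comp_mpolyZ, map_mpolyZ) map_mpolyX !comp_mpolyX.
congr (_ *: _ + _); rewrite rmorph_prod; apply: eq_bigr => i _ /=.
rewrite rmorphXn /= !tnth_mktuple /linear_form raddf_sum; congr (_ ^+ _).
by apply: eq_bigr => j _; rewrite /= map_mpolyZ map_mpolyX mxE.
Qed.

(** * Stability under the inverse of a linear map *)

(** Polynomials of bounded degree are given by their coefficients on finitely
    many monomials, so one more polynomial than there are monomials forces a
    linear relation. *)
Lemma bounded_mpoly_dependent {K : fieldType} {N d : nat}
    {q : nat -> {mpoly K[N]}} :
  (forall k, (msize (q k) <= d)%N) ->
  exists (n : nat) (c : 'rV[K]_n),
    c != 0 /\ \sum_(k < n) c 0 k *: q k = 0.
Proof.
move=> qd; set D := #|{: 'X_{1..N < d}}|.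
pose C : 'M[K]_(D.+1, D) := \matrix_(k, m) (q k)@_(enum_val m : 'X_{1..N < d}).
have : kermx C != 0.
  by rewrite kermx_eq0 /row_free neq_ltn ltnS rank_leq_col.
case/rowV0Pn => c /sub_kermxP cC0 c_neq0; exists D.+1, c; split=> //.
apply/mpolyP => m; rewrite mcoeff0 raddf_sum /=.
have [md|dm] := ltnP (mdeg m) d; last first.
  apply: big1 => k _; rewrite mcoeffZ memN_msupp_eq0 ?mulr0 //.
  exact/msize_mdeg_ge/(leq_trans (qd k)).
have /rowP/(_ (enum_rank (BMultinom md))) := cC0; rewrite !mxE => cC0m.
rewrite -[RHS]cC0m; apply: eq_bigr => k _.
by rewrite mcoeffZ mxE enum_rankK.
Qed.

Lemma iter_mulmx_cancel {K : comUnitRingType} {N : nat} (k : nat) (M : 'M[K]_N)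
    (x : 'cV[K]_N) :
  M \in unitmx -> iter k (mulmx M) (iter k (mulmx (invmx M)) x) = x.
Proof.
by move=> Mu; elim: k x => // k IHk x; rewrite iterSr iterS mulKVmx.
Qed.

(** The relation among the iterates [p o M^k] is evaluated at [M^-(j+1) y],
    where [j] is the least index with a nonzero coefficient: its first term is
    then a nonzero multiple of [p (M^-1 y)], and the other terms are values of
    [p] at [y], [M y], [M^2 y], ..., which are points of [V]. *)
Lemma vanishing_at_preimages {K : fieldType} {N : nat} {V : set 'cV[K]_N}
    {M : 'M[K]_N} {p : {mpoly K[N]}} :
  M \in unitmx -> (forall x, V x -> V (M *m x)) ->
  (forall x, V x -> eval_at p x = 0) ->
  forall y, V y -> eval_at p (invmx M *m y) = 0.
Proof.
move=> Mu MV pV y Vy.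
have [n [c [c_neq0 c_rel]]] :=
  bounded_mpoly_dependent (fun k => msize_iter_mpoly_subst M k p).
have iterV k x : V x -> V (iter k (mulmx M) x).
  by move=> Vx; elim: k => //= k; apply: MV.
have /rV0Pn[i0 ci0] := c_neq0.
have [j cj jmin] := @arg_minnP _ i0 (fun i => c 0 i != 0) val ci0.
pose z := iter j.+1 (mulmx (invmx M)) y.
have := congr1 (fun q => eval_at q z) c_rel.
rewrite {1 2}/eval_at meval0 raddf_sum (bigD1 j) //= big1 ?addr0 => [|k kj].
  rewrite mevalZ; move/eqP; rewrite mulf_eq0 (negbTE cj) /= => /eqP.
  by rewrite -/(eval_at _ z) eval_iter_mpoly_subst /z iterSr iter_mulmx_cancel.
rewrite mevalZ; have [->|ck] := eqVneq (c 0 k) 0; first by rewrite mul0r.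
have jk : (j < k)%N by rewrite ltn_neqAle eq_sym kj jmin.
rewrite -/(eval_at _ z) eval_iter_mpoly_subst -(subnK jk) iterD.
by rewrite /z iter_mulmx_cancel // pV ?mulr0 //; apply: iterV.
Qed.

Lemma zero_set_stable_inv {K : fieldType} {N : nat} (s : seq {mpoly K[N]})
    (M : 'M[K]_N) :
  M \in unitmx -> (forall x, zero_set s x -> zero_set s (M *m x)) ->
  forall y, zero_set s y -> zero_set s (invmx M *m y).
Proof.
move=> Mu MV y Vy p ps.
by apply: (vanishing_at_preimages Mu MV _ _ Vy) => x; apply.
Qed.

(** The columns of the inverse matrix are the preimages of the basis
    vectors. *)
Lemma bijective_mulmx_unit {K : fieldType} {N : nat} (M : 'M[K]_N) :
  bijective (fun x : 'cV[K]_N => M *m x) -> M \in unitmx.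
Proof.
case=> g _ gK; pose B := \matrix_j (g (delta_mx j 0))^T.
suff /mulmx1_unit[] : M *m B^T = 1%:M by [].
apply/matrixP => i j; have /matrixP/(_ i 0) := gK (delta_mx j 0).
rewrite !mxE eqxx andbT => <-.
by apply: eq_bigr => k _; rewrite !mxE.
Qed.

(** * Rational maps at a generic point *)

(** The pullback of a rational equation of [V] by [M] is again a rational
    polynomial, and it vanishes at [l]; genericity spreads this to all of
    [V]. *)
Lemma generic_point_map_stable {R : realType} {N : nat} {V : set 'cV[R[i]]_N}
    {l : 'cV[R[i]]_N} {M : 'M[rat]_N} :
  variety_over_Q V -> generic_point V l -> V (map_mx ratr M *m l) ->
  forall x, V x -> V (map_mx ratr M *m x).
Proof.
move=> [s ->] [_ gen] Ml x Vx _ /mapP[p ps ->].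
rewrite -eval_mpoly_subst /complexify -map_mpoly_subst.
apply: gen (Vx); rewrite /complexify map_mpoly_subst eval_mpoly_subst.
by apply: Ml; apply: map_f.
Qed.

Theorem theorem1p2 (R : realType) (N : nat) (V : set 'cV[R[i]]_N)
    (l : 'cV[R[i]]_N) (A : {linear 'cV[R[i]]_N -> 'cV[R[i]]_N})
    (hVirr : irreducible_variety V) (hVQ : variety_over_Q V)
    (hl : generic_point V l)
    (hAbij : bijective A) (hAQ : map_over_Q A) (hAl : V (A l)) :
  A @` V = V /\ linear_automorphism V A.
Proof.
suff AV : A @` V = V by split.
have [M AM] := hAQ; set MC := map_mx _ M in AM.
have MCu : MC \in unitmx by apply: bijective_mulmx_unit; apply: eq_bij AM.
have MV x : V x -> V (MC *m x).
  by apply: generic_point_map_stable hVQ hl _ x; rewrite -AM.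
apply/seteqP; split=> [_ [x Vx <-]|y Vy]; first by rewrite AM; apply: MV.
exists (invmx MC *m y); last by rewrite AM mulKVmx.
have [s Vs] := hVQ; rewrite Vs in MV Vy *.
exact: zero_set_stable_inv MCu MV _ Vy.
Qed.
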